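(* Let $\mathfrak{h}(\lambda,\mu,\varphi,\operatorname{ad}_{\mathfrak{h}}^{\ast})$ be a Lie algebra on the vector space $\mathfrak{h}\oplus\mathfrak{a}\oplus\mathfrak{h}^{\ast}$ as described in the context, and let $B_{\mathfrak{a}}$ be a symmetric and non-degenerate bilinear form on $\mathfrak{a}$. The symmetric and non-degenerate bilinear form $B$ on $\mathfrak{h}\oplus\mathfrak{a}\oplus\mathfrak{h}^{\ast}$ defined by $$B(x+u+\alpha,\,y+v+\beta)=\alpha(y)+\beta(x)+B_{\mathfrak{a}}(u,v)\qquad (x,y\in\mathfrak{h},\ u,v\in\mathfrak{a},\ \alpha,\beta\in\mathfrak{h}^{\ast})$$ is invariant if and only if $$\varphi(x)(u)(y)=-B_{\mathfrak{a}}(\lambda(x,y),u)\quad\text{and}\quad \mu(x,y)(z)=\mu(y,z)(x)\qquad\text{for all }x,y,z\in\mathfrak{h},\ u\in\mathfrak{a}.$$ In addition, every nilpotent non-abelian quadratic Lie algebra can be identified with this construction; that is, it is isometrically isomorphic to some $\mathfrak{h}(\lambda,\mu,\varphi,\operatorname{ad}_{\mathfrak{h}}^{\ast})$ equipped with an invariant metric $B$ given by $B(x+u+\alpha,\,y+v+\beta)=\alpha(y)+\beta(x)+B_{\mathfrak{a}}(u,v)$ for all $x,y\in\mathfrak{h}$, $u,v\in\mathfrak{a}$, $\alpha,\beta\in\mathfrak{h}^{\ast}$, where $B_{\mathfrak{a}}$ is some symmetric and non-degenerate bilinear form on $\mathfrak{a}$.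
   Context: All algebras and vector spaces are finite dimensional over a field $\mathbb{F}$ of characteristic zero. A bilinear form $B$ on a Lie algebra $\mathfrak{g}$ is invariant if $B([x,y],z)=-B(y,[x,z])$ for all $x,y,z$; an invariant metric is a non-degenerate, symmetric, invariant bilinear form; a quadratic Lie algebra is a Lie algebra equipped with an invariant metric. An isometric isomorphism of quadratic Lie algebras is a Lie algebra isomorphism preserving the metrics. The Lie algebra $\mathfrak{h}(\lambda,\mu,\varphi,\operatorname{ad}_{\mathfrak{h}}^{\ast})$: the data are a Lie algebra $(\mathfrak{h},[\cdot,\cdot]_{\mathfrak{h}})$ with coadjoint representation $\operatorname{ad}_{\mathfrak{h}}^{\ast}(x)(\alpha)=-\alpha\circ\operatorname{ad}_{\mathfrak{h}}(x)$ on $\mathfrak{h}^{\ast}$; a vector space $\mathfrak{a}$ (trivial $\mathfrak{h}$-module); a linear map $\varphi:\mathfrak{h}\to\operatorname{Hom}(\mathfrak{a},\mathfrak{h}^{\ast})$ with $\varphi([x,y]_{\mathfrak{h}})=\operatorname{ad}_{\mathfrak{h}}^{\ast}(x)\circ\varphi(y)-\operatorname{ad}_{\mathfrak{h}}^{\ast}(y)\circ\varphi(x)$; and skew-symmetric bilinear maps $\lambda:\mathfrak{h}\times\mathfrak{h}\to\mathfrak{a}$, $\mu:\mathfrak{h}\times\mathfrak{h}\to\mathfrak{h}^{\ast}$ satisfying $\mathrm{d}_{\mathfrak{a}}(\lambda)=0$ and $e_\varphi(\lambda)+\mathrm{d}_{\operatorname{ad}_{\mathfrak{h}}^{\ast}}(\mu)=0$.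 Here $\mathrm{d}_{\mathfrak{a}}$, $\mathrm{d}_{\operatorname{ad}_{\mathfrak{h}}^{\ast}}$ are the Chevalley–Eilenberg differentials of $\mathfrak{h}$ with values in the trivial module $\mathfrak{a}$ and in the coadjoint module $\mathfrak{h}^{\ast}$, and $e_\varphi(\lambda)(x,y,z)=\varphi(x)(\lambda(y,z))+\varphi(y)(\lambda(z,x))+\varphi(z)(\lambda(x,y))$. The Lie bracket on $\mathfrak{h}\oplus\mathfrak{a}\oplus\mathfrak{h}^{\ast}$ is the skew-symmetric bilinear map with $[x,y]=[x,y]_{\mathfrak{h}}+\lambda(x,y)+\mu(x,y)$, $[x,u+\alpha]=\varphi(x)(u)+\operatorname{ad}_{\mathfrak{h}}^{\ast}(x)(\alpha)$, $[u+\alpha,v+\beta]=0$. *)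

(* Defs.v *)
From HB Require Import structures.
From mathcomp Require Import all_boot all_algebra ring.

Set Implicit Arguments.
Unset Strict Implicit.
Unset Printing Implicit Defensive.

Import GRing.Theory.
Local Open Scope ring_scope.

HB.mixin Record Vector_isLieAlgebra (F : fieldType) L of Vector F L := {
  lie_bracket : L -> L -> L;
  lie_bilinear : bilinear_for *:%R *:%R lie_bracket;
  lie_alternating : forall x, lie_bracket x x = 0;
  lie_jacobi : forall x y z,
    lie_bracket x (lie_bracket y z) + lie_bracket y (lie_bracket z x)
      + lie_bracket z (lie_bracket x y) = 0
}.

#[short(type="lieAlgType")]
HB.structure Definition LieAlgebra (F : fieldType) :=
  {L of Vector_isLieAlgebra F L & Vector F L}.

Notation "[ 'lie' x , y ]" := (lie_bracket x y)
  (at level 0, x at level 99, y at level 99, format "[ 'lie'  x ,  y ]")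
  : ring_scope.

HB.instance Definition _ (F : fieldType) (L : lieAlgType F) :=
  bilinear_isBilinear.Build F L L L *:%R *:%R (@lie_bracket F L) lie_bilinear.
HB.instance Definition _ (F : fieldType) (L : lieAlgType F) (x : L) :=
  GRing.isLinear.Build F L L *:%R (lie_bracket x) (lie_bilinear.2 x).

Section LieTheory.
Variables (F : fieldType) (L : lieAlgType F).
Implicit Types (x y z : L) (U V : {vspace L}).

Lemma lieC x y : [lie x, y] = - [lie y, x].
Proof.
apply/eqP; rewrite -addr_eq0; apply/eqP.
have := lie_alternating (x + y).
by rewrite linearDl !linearDr /= !lie_alternating add0r addr0.
Qed.

Definition lie_abelian := forall x y, [lie x, y] = 0.

(* The span of all [lie u, v] with u \in U and v \in V; by bilinearity bases
   suffice. *)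
Definition liev U V : {vspace L} :=
  <<[seq [lie u, v] | u <- vbasis U, v <- vbasis V]>>%VS.

Definition lower_central n : {vspace L} := iter n (liev fullv) fullv.

Definition lie_nilpotent := exists n, lower_central n = 0%VS.

Definition ad x : 'End(L) := linfun (lie_bracket x).

Definition lie_invariant (B : {symmetric L}) :=
  forall x y z, B [lie x, y] z = - B y [lie x, z].

Definition invariant_metric (B : {symmetric L}) :=
  nondegenerate B /\ lie_invariant B.

Lemma adE x y : ad x y = [lie x, y].
Proof. by rewrite lfunE. Qed.

Definition coad x (alpha : 'Hom(L, F^o)) : 'Hom(L, F^o) :=
  - (alpha \o ad x)%VF.

Lemma coadE x alpha y : coad x alpha y = - alpha [lie x, y].
Proof. by rewrite /coad !lfunE /= lfunE /= adE. Qed.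

(* The Chevalley-Eilenberg differential of a 2-cochain c with values in the
   module given by rho. *)
Definition CE_d2 (V : zmodType) (rho : L -> V -> V) (c : L -> L -> V) x y z : V :=
  rho x (c y z) - rho y (c x z) + rho z (c x y)
    - c [lie x, y] z + c [lie x, z] y - c [lie y, z] x.

End LieTheory.

Section Extension.
Variables (F : fieldType) (h : lieAlgType F) (a : vectType F).
Local Notation "h ^d" := 'Hom(h, F^o) (at level 2, format "h ^d") : type_scope.

Record ext_data := ExtData {
  ext_lambda : {bilinear h -> h -> a};
  ext_mu : {bilinear h -> h -> h^d};
  ext_phi : 'Hom(h, 'Hom(a, h^d));
  ext_lambdaC : forall x y, ext_lambda x y = - ext_lambda y x;
  ext_muC : forall x y, ext_mu x y = - ext_mu y x;
  ext_phi_cocycle : forall x y u,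
    ext_phi [lie x, y] u = coad x (ext_phi y u) - coad y (ext_phi x u);
  ext_lambda_closed : forall x y z, CE_d2 (fun _ _ => 0) ext_lambda x y z = 0;
  ext_mu_closed : forall x y z,
    (ext_phi x (ext_lambda y z) + ext_phi y (ext_lambda z x)
      + ext_phi z (ext_lambda x y)) + CE_d2 (@coad F h) ext_mu x y z = 0
}.

(* The triple (x, u, alpha) stands for x + u + alpha.
   Skew-symmetry of lambda and mu only yields an alternating bracket when the
   characteristic is not 2, hence the dependency on char0. *)
Definition ext (char0 : has_pchar0 F) (D : ext_data) : Type :=
  (h * a * h^d)%type.

Variables (char0 : has_pchar0 F) (D : ext_data).
Local Notation g := (ext char0 D).
HB.instance Definition _ := Vector.copy g (h * a * h^d)%type.

Let lambda := ext_lambda D.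
Let mu := ext_mu D.
Let phi := ext_phi D.

Definition ext_bracket (p q : g) : g :=
  let: (x, u, alpha) := p in
  let: (y, v, beta) := q in
  ([lie x, y], lambda x y,
   mu x y + (phi x v + coad x beta) - (phi y u + coad y alpha)).

Fact coad_linear x : linear (@coad F h x).
Proof.
move=> k al be; apply/lfunP=> y.
by rewrite coadE !add_lfunE !scale_lfunE !coadE opprD scalerN.
Qed.
HB.instance Definition _ x :=
  GRing.isLinear.Build F h^d h^d *:%R (@coad F h x) (coad_linear x).

(* Stated separately because linearD and linearN can unfold coad. *)
Let coadN x (al : h^d) : coad x (- al) = - coad x al.
Proof. exact: linearN. Qed.
Let coadD x (al be : h^d) : coad x (al + be) = coad x al + coad x be.
Proof. exact: linearD. Qed.
Let coadDB x (al be ga : h^d) :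
  coad x (al + be - ga) = coad x al + coad x be - coad x ga.
Proof. by rewrite !coadD coadN. Qed.

Fact coad_linearl (al : h^d) : linear (fun x : h => coad x al).
Proof.
move=> k x y; apply/lfunP=> z.
by rewrite coadE add_lfunE scale_lfunE !coadE linearPl linearP opprD scalerN.
Qed.

Lemma coad_lie (x y : h) (al : h^d) :
  coad [lie x, y] al = coad x (coad y al) - coad y (coad x al).
Proof.
apply/lfunP=> z; rewrite add_lfunE !coadE opp_lfunE !coadE !opprK.
have /(congr1 al) := lie_jacobi x y z.
rewrite (lieC z x) (lieC z [lie x, y]) linearN !linearD !linearN linear0 /=.
by move/eqP; rewrite subr_eq0 => /eqP <-; rewrite opprD opprK addrC.
Qed.

Let ext_actK x y u (al : h^d) :
  phi [lie x, y] u + coad [lie x, y] al =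
    coad x (phi y u + coad y al) - coad y (phi x u + coad x al).
Proof. by rewrite ext_phi_cocycle coad_lie !coadD opprD addrACA. Qed.

Fact ext_bracket_bilinear : bilinear_for *:%R *:%R ext_bracket.
Proof.
split=> [[[y v] be] | [[x u] al]] k.
  move=> [[x1 u1] al1] [[x2 u2] al2]; congr (_, _, _); rewrite ?linearPl //=.
  rewrite (coad_linearl be k x1 x2) !linearP add_lfunE scale_lfunE /=.
  rewrite [in RHS]scalerBr [RHS]addrACA -opprD; congr (_ - _).
    rewrite [in RHS]scalerDr [RHS]addrACA; congr (_ + _).
    by rewrite [in RHS]scalerDr [RHS]addrACA.
  by rewrite [in RHS]scalerDr [RHS]addrACA.
move=> [[y1 v1] be1] [[y2 v2] be2]; congr (_, _, _); rewrite ?linearPr //=.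
rewrite (coad_linearl al k y1 y2) !linearP add_lfunE scale_lfunE /=.
rewrite [in RHS]scalerBr [RHS]addrACA -opprD; congr (_ - _).
  rewrite [in RHS]scalerDr [RHS]addrACA; congr (_ + _).
  by rewrite [in RHS]scalerDr [RHS]addrACA.
by rewrite [in RHS]scalerDr [RHS]addrACA.
Qed.

Lemma charF_skew (V : lmodType F) (x : V) : x = - x -> x = 0.
Proof.
move/eqP; rewrite -addr_eq0 -mulr2n -scaler_nat scaler_eq0 => /orP[|/eqP //].
by rewrite (pcharf0P F).1.
Qed.

Fact ext_alternating p : ext_bracket p p = 0.
Proof.
case: p => [[x u] al]; congr (_, _, _).
- exact: lie_alternating.
- exact/charF_skew/ext_lambdaC.
- by rewrite addrK; apply/charF_skew/ext_muC.
Qed.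

Fact ext_jacobi_sum (V : zmodType)
    (L1 L2 L3 M1 M2 M3 N1 N2 N3 A1 A2 A3 B1 B2 B3 : V) :
    L1 + L2 + L3 + (M1 + M2 + M3 + N3 + N2 + N1) = 0 ->
  N1 + (L1 + (M1 + A1 - B1)) - (A2 - B3)
    + (N2 + (L2 + (M2 + A2 - B2)) - (A3 - B1))
    + (N3 + (L3 + (M3 + A3 - B3)) - (A1 - B2)) = 0.
Proof.
move=> LMN0; rewrite !opprB !addrA.
rewrite [LHS](ACl ((2*9*16)*(3*10*17*15*8*1)
  *((4*21)*(13*5)*(6*19)*(11*7)*(20*12)*(18*14))))/=.
by rewrite LMN0 !subrr !addr0.
Qed.

Fact ext_jacobi p q r :
    ext_bracket p (ext_bracket q r) + ext_bracket q (ext_bracket r p)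
      + ext_bracket r (ext_bracket p q) = 0.
Proof.
move: p q r => [[x u] al] [[y v] be] [[z w] ga]; congr (_, _, _).
- exact: lie_jacobi.
- have := ext_lambda_closed D x y z; rewrite /CE_d2.
  rewrite !(ext_lambdaC D [lie _, _]) (lieC x z) linearNr.
  rewrite subr0 !add0r !opprK => lam0.
  by rewrite -[RHS]lam0 /= addrC [X in _ + X]addrC addrA.
- rewrite /= !ext_actK !coadDB; apply: ext_jacobi_sum.
  have := ext_mu_closed D x y z; rewrite /CE_d2.
  rewrite (ext_muC D x z) coadN !(ext_muC D [lie _, _]) (lieC x z) linearNr.
  by rewrite !opprK.
Qed.

HB.instance Definition _ := Vector_isLieAlgebra.Build F g
  ext_bracket_bilinear ext_alternating ext_jacobi.

Variable Ba : {symmetric a}.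

Definition ext_form (p q : g) : F :=
  let: (x, u, alpha) := p in
  let: (y, v, beta) := q in
  alpha y + beta x + Ba u v.

Fact ext_form_sym p q : ext_form p q = (-1) ^+ false * idfun (ext_form q p).
Proof.
rewrite mul1r; case: p q => [[x u] al] [[y v] be] /=.
by rewrite (hermC Ba) mul1r [al y + _]addrC.
Qed.

Fact ext_form_bilinear : bilinear_for *%R *%R ext_form.
Proof.
have lin_r p : linear_for *%R (ext_form p).
  case: p => [[x u] al] k [[y1 v1] be1] [[y2 v2] be2] /=.
  rewrite linearP add_lfunE scale_lfunE linearPr /= /GRing.scale /=.
  by ring.
split=> // q k p1 p2; have := lin_r q k p1 p2.
by rewrite !(ext_form_sym q) !mul1r.
Qed.

HB.instance Definition _ := bilinear_isBilinear.Build F g g F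
  *%R (idfun \; *%R) ext_form ext_form_bilinear.
HB.instance Definition _ :=
  isHermitianSesquilinear.Build F g false idfun ext_form ext_form_sym.

End Extension.

Arguments ext_form {F h a} char0 D Ba p q.

(* Main.v *)
Require Import Defs.
From HB Require Import structures.
From mathcomp Require Import all_boot all_algebra.
From mathcomp Require Import ring.

Set Implicit Arguments.
Unset Strict Implicit.
Unset Printing Implicit Defensive.

Import GRing.Theory.
Local Open Scope ring_scope.

(** The equivalence is a computation: the value of B on a bracket and a third
    vector is a sum of seven terms, and comparing it with the value obtained
    after exchanging the last two arguments pairs phi with Ba o lambda and
    forces the cyclic symmetry of mu ([ext_form_invariant]).

    For the second part, let g be a nilpotent Lie algebra with invariant metric
    B.  Among the abelian ideals of g, one that cannot be enlarged contains its
    own centralizer: otherwise, by nilpotency, some x outside J centralizes J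
    and satisfies [g, x] <= J, and J + F x is a larger abelian ideal
    ([self_centralizing_ideal]).  For an ideal J, invariance of B gives
    [J^perp, J] = 0 ([orthov_centralizer]); hence here J^perp <= J.

    Put h = g / J, and let a be a complement of J^perp in J; the restriction Ba
    of B to a is non-degenerate, and B identifies J^perp with h^*.  Projecting
    a section of g -> h orthogonally to a, and then correcting it by half of
    the form that it induces on h, with values in J^perp, produces an isotropic
    copy of h orthogonal to a ([witt_splitting_exists]).  Thus g = h + a + h^*
    with B in the required shape.

    The bracket is then read off the decomposition.  Since J is abelian,
    invariance gives [g, J] <= J^perp, so that the bracket of x in h with an
    element of J has only a component in h^*: on a this defines phi, while on
    h^* invariance says that it is the coadjoint action ([coad_splitE]).  The
    components of the bracket of two elements of h along a and h^* are lambda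
    and mu, and the cocycle conditions are the components of the Jacobi
    identity of g.  If g is abelian the argument still applies, with h = 0. *)

(** * Duality for symmetric forms *)

(** [linfun f] is defined for every function f; this gives its value when
    linearity of f is available only as a proof. *)
Lemma linfunE (F : fieldType) (U V : vectType F) (f : U -> V) :
  linear f -> linfun f =1 f.
Proof.
move=> lin_f.
pose g : {linear U -> V} := HB.pack f (GRing.isLinear.Build F U V *:%R f lin_f).
exact: (lfunE g).
Qed.

(** The dual of a finite dimensional space separates its points. *)
Lemma dual_eq0 (F : fieldType) (V : vectType F) (x : V) :
  (forall al : 'Hom(V, F^o), al x = 0) -> x = 0.
Proof.
move=> al0; rewrite (coord_vbasis (memvf x)) big1 // => i _.
pose al : 'Hom(V, F^o) := linfun (coord (vbasis fullv) i : V -> F^o).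
have /= := al0 al; rewrite linfunE => [->|]; first exact: scale0r.
by move=> k u v; rewrite linearP.
Qed.

Section SymmetricForms.
Variables (F : fieldType) (V : vectType F) (B : {symmetric V}).
Local Notation "V ^d" := 'Hom(V, F^o) (at level 2, format "V ^d") : type_scope.

Lemma symC x y : B x y = B y x.
Proof. by rewrite (hermC B) mul1r. Qed.

Lemma nondegenerateP :
  nondegenerate B <-> (forall x, (forall y, B x y = 0) -> x = 0).
Proof.
split=> [/eqP B0 x Bx|B0].
  by apply/eqP; rewrite -memv0 -B0; apply/mem_orthovP => y _; apply: Bx.
rewrite /nondegenerate -subv0; apply/subvP => x /mem_orthovP Bx.
by rewrite memv0; apply/eqP/B0 => y; apply/Bx/memvf.
Qed.

(** The map from V to its dual induced by B. *)
Definition flat : 'Hom(V, V^d) := linfun (fun x => linfun (B x : V -> F^o)).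

Lemma flatE x y : flat x y = B x y.
Proof.
have flat1 z : linfun (B z : V -> F^o) =1 B z.
  by apply: linfunE => k u v; rewrite linearPr.
rewrite [flat]lock -lock linfunE ?flat1 // => k u v.
by apply/lfunP => w; rewrite add_lfunE scale_lfunE !flat1 linearPl.
Qed.

(** The inverse of [flat] when B is non-degenerate: [sharp al] represents the
    linear form al.  In general it is only a pseudo-inverse. *)
Definition sharp : 'Hom(V^d, V) := (flat^-1)%VF.

Lemma sharpE al y : nondegenerate B -> B (sharp al) y = al y.
Proof.
move/nondegenerateP => B0; rewrite -flatE /sharp limg_lfunVK //.
suff -> : limg flat = fullv by apply: memvf.
apply/eqP; rewrite eqEdim subvf /= limg_dim_eq; last first.
  rewrite capfv; apply/eqP/lker0P => x z /lfunP E; apply/eqP.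
  rewrite -subr_eq0; apply/eqP/B0 => w; have := E w; rewrite !flatE.
  by move=> Ew; rewrite linearBl /= Ew subrr.
by rewrite !dimvf /dim /= muln1.
Qed.
End SymmetricForms.

(** * The invariance criterion *)

Section Invariance.
Variables (F : fieldType) (char0 : has_pchar0 F).
Variables (h : lieAlgType F) (a : vectType F) (D : ext_data h a).
Variable Ba : {symmetric a}.

Lemma ext_form_nondegenerate :
  nondegenerate Ba -> nondegenerate (ext_form char0 D Ba).
Proof.
move=> /nondegenerateP Q; apply/nondegenerateP.
move=> [[x u] al] E; congr (_, _, _).
- apply: dual_eq0 => be; have /= := E (0, 0, be).
  by rewrite linear0 linear0r add0r addr0.
- apply: Q => v; have /= := E (0, v, 0).
  by rewrite zero_lfunE linear0 !add0r.
apply/lfunP => y; have /= := E (y, 0, 0).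
by rewrite !zero_lfunE linear0r !addr0.
Qed.

Lemma ext_form_invariant :
  lie_invariant (ext_form char0 D Ba) <->
     (forall (x y : h) (u : a), ext_phi D x u y = - Ba (ext_lambda D x y) u) /\
     (forall x y z : h, ext_mu D x y z = ext_mu D y z x).
Proof.
(* T is the value of B on the bracket of the first two vectors and the third
   one; invariance expresses a sign change when the last two are exchanged. *)
pose T x u (al : 'Hom(h, F^o)) y v (be : 'Hom(h, F^o)) z w (ga : 'Hom(h, F^o)) : F :=
  ext_mu D x y z + ext_phi D x v z - be [lie x, z]
      - (ext_phi D y u z - al [lie y, z]) + ga [lie x, y]
      + Ba (ext_lambda D x y) w.
have TE x u al y v be z w ga : ext_form char0 D Ba
    [lie ((x, u, al) : ext char0 D), (y, v, be)] (z, w, ga) = T x u al y v be z w ga.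
  rewrite /= !add_lfunE !opp_lfunE !add_lfunE ?coadE ?(comp_lfunE, adE) ?addrA.
  reflexivity.
have invE : lie_invariant (ext_form char0 D Ba) <-> forall x u al y v be z w ga,
    T x u al y v be z w ga = - T x u al z w ga y v be.
  split=> inv.
    move=> *; rewrite -!TE [X in - X]ext_form_sym mul1r; exact: inv.
  move=> [[x u] al] [[y v] be] [[z w] ga].
  have := inv x u al y v be z w ga.
  by rewrite -!TE [X in - X]ext_form_sym mul1r; apply.
apply: (iff_trans invE); rewrite /T; split=> [inv|[phiE muE] x u al y v be z w ga].
  split=> [x y u|x y z].
    (* The relation for x, y in h and u in a. *)
    have := inv x 0 0 y 0 0 0 u 0.
    rewrite !(linear0, zero_lfunE) !(addr0, add0r, oppr0).
    by move->; rewrite opprK.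
  (* The relation for three vectors of h; together with skew-symmetry it gives
     the cyclic invariance of mu. *)
  have mu_rot p q r : ext_mu D p q r = - ext_mu D p r q.
    have := inv p 0 0 q 0 0 r 0 0.
    by rewrite !(linear0, zero_lfunE) !(addr0, add0r, oppr0).
  by rewrite mu_rot ext_muC opp_lfunE opprK mu_rot ext_muC opp_lfunE opprK.
rewrite !phiE (ext_lambdaC D z y) linearNl (lieC z y) linearN /=.
rewrite (ext_muC D x z) opp_lfunE -(muE z x y) [ext_mu D z x y]muE.
by ring.
Qed.
End Invariance.

(** * Self-centralizing abelian ideals *)

Section AbelianIdeals.
Variables (F : fieldType) (g : lieAlgType F).
Implicit Types (U V J : {vspace g}).

(** Expansion of a bracket in which the two second summands commute. *)
Lemma lieD_abelian (x1 x2 j1 j2 : g) : [lie j1, j2] = 0 ->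
  [lie x1 + j1, x2 + j2] = [lie x1, x2] + [lie x1, j2] - [lie x2, j1].
Proof.
by move=> j0; rewrite linearDl !linearDr /= j0 addr0 (lieC j1 x2).
Qed.

(** Stability under left brackets; two-sided by antisymmetry. *)
Definition lie_ideal J :=
  forall s, {in J, forall j, [lie s, j] \in J}.

Lemma mem_liev U V u v : u \in U -> v \in V -> [lie u, v] \in liev U V.
Proof.
move=> uU vV; rewrite (coord_vbasis uU) (coord_vbasis vV).
rewrite linear_sumr rpred_sum // => j _; rewrite linear_sumlz rpred_sum // => i _.
rewrite linearZl_LR linearZr_LR /= !rpredZ //.
by apply/memv_span/allpairs_f; apply: mem_nth; rewrite size_tuple.
Qed.

(** The centralizer of J, as the kernel of the map sending x to the restriction
    of ad x to J (extended by 0 on a complement). *)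
Definition centralizer J : {vspace g} :=
  lker (linfun (fun x => (ad x \o projv J)%VF)).

Lemma centralizerP J x :
  reflect {in J, forall j, [lie x, j] = 0} (x \in centralizer J).
Proof.
rewrite memv_ker linfunE; last first.
  move=> k y z; apply/lfunP => t.
  by rewrite add_lfunE scale_lfunE !comp_lfunE !adE linearPl.
apply: (iffP eqP) => [/lfunP x0 j jJ|x0].
  by have := x0 j; rewrite comp_lfunE adE projv_id // zero_lfunE.
by apply/lfunP => t; rewrite comp_lfunE adE zero_lfunE x0 ?memv_proj.
Qed.

Lemma centralizer_ideal J : lie_ideal J -> lie_ideal (centralizer J).
Proof.
move=> J_ideal s x /centralizerP xC; apply/centralizerP => j jJ.
have := lie_jacobi s x j.
rewrite xC // linear0 add0r (lieC j s) linearN /= xC ?J_ideal // oppr0 add0r.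
by move=> js0; rewrite lieC js0 oppr0.
Qed.

(** J is commutative when it lies in its own centralizer. *)
Definition abelian_ideal J := lie_ideal J /\ (J <= centralizer J)%VS.

(** In a nilpotent Lie algebra, an ideal V not contained in J has an element
    outside J that is central modulo J. *)
Lemma nilpotent_central_mod J V : lie_nilpotent g -> lie_ideal V ->
  ~~ (V <= J)%VS ->
  exists x, [/\ x \in V, x \notin J & forall s, [lie s, x] \in J].
Proof.
move=> [n Ln] V_ideal /subvPn[x xV xJ].
(* Bracketing x in V \ J with elements of g moves it down the lower central
   series, which ends inside J; the last element outside J is the one sought.
   The induction is on the number n of steps left, k being the current one. *)
have L0 : (lower_central g (0 + n) <= J)%VS by rewrite Ln sub0v.
have x0 : x \in lower_central g 0 by apply: memvf.
elim: n 0%N x xV xJ x0 L0 {Ln} => [|n IHn] k x xV xJ xk Lk.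
  by rewrite addn0 in Lk; rewrite (subvP Lk) in xJ.
have [xJs|/subvPn[_ /memv_imgP[s _ ->]]] := boolP (limg (ad x) <= J)%VS.
  exists x; split=> // s; rewrite lieC memvN -adE.
  exact: (subvP xJs _ (memv_img _ (memvf s))).
rewrite adE lieC memvN => sxJ.
by apply: (IHn k.+1 [lie s, x]); rewrite ?V_ideal ?mem_liev ?memvf // addSnnS.
Qed.

(** An abelian ideal that does not contain its centralizer can be enlarged by
    a line. *)
Lemma abelian_ideal_extend J : lie_nilpotent g -> abelian_ideal J ->
  ~~ (centralizer J <= J)%VS ->
  exists2 J', abelian_ideal J' & (\dim J < \dim J')%N.
Proof.
move=> g_nil [J_ideal J_ab].
case/(nilpotent_central_mod g_nil (centralizer_ideal J_ideal)) => x [xC xJ sx].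
have J'P w : w \in (J + <[x]>)%VS -> exists j c, j \in J /\ w = j + c *: x.
  by case/memv_addP => j jJ [_ /vlineP[c ->] ->]; exists j, c.
exists (J + <[x]>)%VS; first split.
- move=> s _ /J'P[j [c [jJ ->]]].
  rewrite linearD linearZ /=; apply: (subvP (addvSl _ _)).
  by rewrite rpredD ?rpredZ ?sx ?J_ideal.
- apply/subvP => _ /J'P[j [c [jJ ->]]]; apply/centralizerP.
  move=> _ /J'P[k [d [kJ ->]]].
  have jk := centralizerP _ _ (subvP J_ab _ jJ) _ kJ.
  have xj := centralizerP _ _ xC _ jJ; have xk := centralizerP _ _ xC _ kJ.
  rewrite linearDl !linearDr linearZl_LR !linearZr_LR /= linearZl_LR /=.
  by rewrite jk xk (lieC j) xj lie_alternating oppr0 !scaler0 !addr0.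
- rewrite dimv_disjoint_sum.
    by rewrite dim_vline; case: eqP xJ => [->|]; rewrite ?mem0v ?addn1.
  apply/eqP; rewrite -subv0; apply/subvP => w /memv_capP[wJ /vlineP[c wE]].
  by move: wJ; rewrite wE rpredZeq (negPf xJ) orbF => /eqP ->; rewrite scale0r mem0v.
Qed.

Lemma self_centralizing_ideal : lie_nilpotent g ->
  exists2 J, abelian_ideal J & (centralizer J <= J)%VS.
Proof.
move=> g_nil.
suff H n J : abelian_ideal J -> (\dim {:g} - \dim J < n)%N ->
    exists2 J, abelian_ideal J & (centralizer J <= J)%VS.
  apply: (H _ 0%VS) (ltnSn _); split; last exact: sub0v.
  by move=> s j; rewrite memv0 => /eqP ->; rewrite linear0 mem0v.
elim: n J => // n IHn J J_ab ltn.
have [CJ|] := boolP (centralizer J <= J)%VS; first by exists J.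
case/(abelian_ideal_extend g_nil J_ab) => J' J'_ab ltJ.
apply: (IHn J') => //; rewrite ltnS in ltn; apply: leq_trans ltn.
by rewrite ltn_sub2l // (leq_trans ltJ) ?dimvS ?subvf.
Qed.

(** Invariance moves a bracket [i, j] paired with s to the pairing of i with
    [s, j], an element of J. *)
Lemma orthov_centralizer (B : {symmetric g}) J :
  invariant_metric B -> lie_ideal J -> (orthov B J <= centralizer J)%VS.
Proof.
move=> [B0 B_inv] J_ideal; apply/subvP => i /mem_orthovP iJ.
apply/centralizerP => j jJ; apply: ((nondegenerateP B).1 B0) => s.
rewrite B_inv lieC linearNr /= opprK; have := iJ _ (J_ideal s j jJ).
by rewrite symC B_inv => /eqP; rewrite oppr_eq0 => /eqP.
Qed.
End AbelianIdeals.

(** * Quotients by ideals *)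

Section Compression.
Variables (F : fieldType) (g : lieAlgType F) (V W : vectType F).

(** The bracket of g pulled back along i and then projected by P.  It yields
    the bracket of a quotient as well as the cochains lambda and mu. *)
Definition compress_lie (i : 'Hom(V, g)) (P : 'Hom(g, W)) (x y : V) : W :=
  P [lie i x, i y].

Variables (i : 'Hom(V, g)) (P : 'Hom(g, W)).

Fact compress_lie_bilinear : bilinear_for *:%R *:%R (compress_lie i P).
Proof.
by split=> z k x y; rewrite /compress_lie linearP ?linearPl ?linearPr linearP.
Qed.

HB.instance Definition _ := bilinear_isBilinear.Build F V V W *:%R *:%R
  (compress_lie i P) compress_lie_bilinear.

Lemma compress_lieC x y : compress_lie i P x y = - compress_lie i P y x.
Proof. by rewrite /compress_lie lieC linearN. Qed.
End Compression.

Section Quotient.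
Variables (F : fieldType) (g : lieAlgType F).
Variables (J : {vspace g}) (J_ideal : lie_ideal J).

(** The quotient g / J, carried by the complement [J^C] of J.  The proof that J
    is an ideal is a parameter of the type, since the Lie algebra structure
    depends on it. *)
Definition lie_quotient (J_ideal : lie_ideal J) : Type := subvs_of (J^C)%VS.
Local Notation h := (lie_quotient J_ideal).
HB.instance Definition _ := Vector.on h.

(** The canonical projection of g onto g / J. *)
Definition quotient_map : 'Hom(g, h) :=
  linfun (fun s => vsproj (J^C)%VS (s - projv J s)).

(** The linear section of [quotient_map] given by the inclusion of [J^C]. *)
Definition quotient_lift : 'Hom(h, g) := linfun (vsval : h -> g).

Let quotient_liftE (x : h) : quotient_lift x = vsval x.
Proof. exact: lfunE. Qed.

Lemma quotient_mapK s : quotient_lift (quotient_map s) = s - projv J s.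
Proof.
rewrite quotient_liftE linfunE ?vsprojK ?memv_projC // => k x y.
rewrite -linearP; congr (vsproj _ _).
by rewrite linearP opprD addrACA scalerBr.
Qed.

Lemma quotient_liftK : cancel quotient_lift quotient_map.
Proof.
move=> x; apply: val_inj => /=; rewrite -quotient_liftE quotient_mapK.
suff /eqP -> : projv J (quotient_lift x) == 0 by rewrite subr0 quotient_liftE.
by rewrite -memv_ker lker_proj quotient_liftE subvsP.
Qed.

Lemma quotient_map_eq0 s : (quotient_map s == 0) = (s \in J).
Proof.
apply/eqP/idP => [/(congr1 quotient_lift)|sJ].
  rewrite quotient_mapK linear0 => /eqP; rewrite subr_eq0 => /eqP ->.
  exact: memv_proj.
by rewrite -(quotient_liftK (_ s)) quotient_mapK projv_id // subrr linear0.
Qed.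

Definition quotient_bracket : h -> h -> h :=
  compress_lie quotient_lift quotient_map.

Lemma quotient_bracketE s t :
  quotient_bracket (quotient_map s) (quotient_map t) = quotient_map [lie s, t].
Proof.
apply/eqP; rewrite -subr_eq0 /quotient_bracket /compress_lie -linearB /=.
rewrite quotient_map_eq0 !quotient_mapK.
set p := projv J s; set q := projv J t.
have -> : [lie s - p, t - q] - [lie s, t] = [lie t - q, p] - [lie s, q].
  rewrite (lieC (t - q)) linearBl /= [in LHS]linearBr /=.
  by rewrite addrAC (addrAC [lie s, t]) subrr add0r addrC.
by rewrite rpredB ?J_ideal ?memv_proj.
Qed.

Fact quotient_bracket_bilinear : bilinear_for *:%R *:%R quotient_bracket.
Proof. exact: compress_lie_bilinear. Qed.

Fact quotient_bracket_alternating x : quotient_bracket x x = 0.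
Proof. by rewrite /quotient_bracket /compress_lie lie_alternating linear0. Qed.

Fact quotient_bracket_jacobi x y z :
  quotient_bracket x (quotient_bracket y z)
    + quotient_bracket y (quotient_bracket z x)
    + quotient_bracket z (quotient_bracket x y) = 0.
Proof.
rewrite -(quotient_liftK x) -(quotient_liftK y) -(quotient_liftK z).
by rewrite !quotient_bracketE -!linearD lie_jacobi linear0.
Qed.

HB.instance Definition _ := Vector_isLieAlgebra.Build F h
  quotient_bracket_bilinear quotient_bracket_alternating quotient_bracket_jacobi.

Lemma quotient_map_lie s t :
  quotient_map [lie s, t] = [lie quotient_map s, quotient_map t].
Proof. by rewrite -quotient_bracketE. Qed.
End Quotient.

(** * Witt splittings *)

Section Witt.
Variables (F : fieldType) (V : vectType F) (B : {symmetric V}).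
Variables (h a : vectType F) (Ba : {symmetric a}).
Local Notation "h ^d" := 'Hom(h, F^o) (at level 2, format "h ^d") : type_scope.

(** An identification of (V, B) with the orthogonal sum of a, equipped with
    Ba, and of the hyperbolic space on h and its dual: the three injections,
    the corresponding projections, and the values of B on the summands.  That
    the maps form a biproduct follows from [witt_decomp] and these values when
    Ba is non-degenerate (lemmas [prj_inj_h] to [prj_d_inj_d]). *)
Record witt_splitting := WittSplitting {
  inj_h : 'Hom(h, V);
  inj_a : 'Hom(a, V);
  inj_d : 'Hom(h^d, V);
  prj_h : 'Hom(V, h);
  prj_a : 'Hom(V, a);
  prj_d : 'Hom(V, h^d);
  witt_decomp : forall s,
    s = inj_h (prj_h s) + inj_a (prj_a s) + inj_d (prj_d s);
  witt_hh : forall x y, B (inj_h x) (inj_h y) = 0;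
  witt_ha : forall x u, B (inj_h x) (inj_a u) = 0;
  witt_dh : forall (al : h^d) x, B (inj_d al) (inj_h x) = al x;
  witt_aa : forall u v, B (inj_a u) (inj_a v) = Ba u v;
  witt_ad : forall u (al : h^d), B (inj_a u) (inj_d al) = 0;
  witt_dd : forall al be : h^d, B (inj_d al) (inj_d be) = 0
}.

Variable W : witt_splitting.
Local Notation ih := (inj_h W).
Local Notation ia := (inj_a W).
Local Notation id := (inj_d W).
Local Notation ph := (prj_h W).
Local Notation pa := (prj_a W).
Local Notation pd := (prj_d W).

Lemma form_inj_h s x : B s (ih x) = pd s x.
Proof.
rewrite {1}(witt_decomp W s) !linearDl /= witt_hh witt_dh (symC _ (ia _)).
by rewrite witt_ha !add0r.
Qed.

Lemma form_inj_a s u : B s (ia u) = Ba (pa s) u.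
Proof.
rewrite {1}(witt_decomp W s) !linearDl /= witt_ha witt_aa (symC _ (id _)).
by rewrite witt_ad addr0 add0r.
Qed.

Lemma form_inj_d s (al : h^d) : B s (id al) = al (ph s).
Proof.
rewrite {1}(witt_decomp W s) !linearDl /= witt_ad witt_dd (symC _ (ih _)).
by rewrite witt_dh !addr0.
Qed.

Lemma witt_formE s t : B s t = pd s (ph t) + pd t (ph s) + Ba (pa s) (pa t).
Proof.
rewrite {1}(witt_decomp W t) !linearDr /= form_inj_h form_inj_a form_inj_d.
by rewrite addrAC.
Qed.

Lemma prj_h_eq0 s : (forall al : h^d, B s (id al) = 0) -> ph s = 0.
Proof. by move=> s0; apply: dual_eq0 => al; rewrite -form_inj_d. Qed.

Lemma prj_inj_h x : ph (ih x) = x.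
Proof.
apply/eqP; rewrite -subr_eq0; apply/eqP/dual_eq0 => al.
by rewrite linearB /= -form_inj_d symC witt_dh subrr.
Qed.

Lemma prj_inj_a u : ph (ia u) = 0.
Proof. by apply: prj_h_eq0 => al; rewrite witt_ad. Qed.

Lemma prj_inj_d (be : h^d) : ph (id be) = 0.
Proof. by apply: prj_h_eq0 => al; rewrite witt_dd. Qed.

Hypothesis Ba_nondeg : nondegenerate Ba.

Lemma prj_a_eq0 s : (forall u, B s (ia u) = 0) -> pa s = 0.
Proof.
by move=> s0; apply: ((nondegenerateP Ba).1 Ba_nondeg) => u; rewrite -form_inj_a.
Qed.

Lemma prj_a_inj_h x : pa (ih x) = 0.
Proof. by apply: prj_a_eq0 => u; rewrite witt_ha. Qed.

Lemma prj_a_inj_a u : pa (ia u) = u.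
Proof.
apply/eqP; rewrite -subr_eq0; apply/eqP.
apply: ((nondegenerateP Ba).1 Ba_nondeg) => v.
by rewrite linearBl /= -form_inj_a witt_aa subrr.
Qed.

Lemma prj_a_inj_d (al : h^d) : pa (id al) = 0.
Proof. by apply: prj_a_eq0 => u; rewrite symC witt_ad. Qed.

Lemma prj_d_inj_h x : pd (ih x) = 0.
Proof. by apply/lfunP => y; rewrite -form_inj_h witt_hh zero_lfunE. Qed.

Lemma prj_d_inj_a u : pd (ia u) = 0.
Proof. by apply/lfunP => y; rewrite -form_inj_h symC witt_ha zero_lfunE. Qed.

Lemma prj_d_inj_d (al : h^d) : pd (id al) = al.
Proof. by apply/lfunP => y; rewrite -form_inj_h witt_dh. Qed.

End Witt.

Section Restriction.
Variables (F : fieldType) (V : vectType F) (B : {symmetric V}) (A : {vspace V}).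

(** The restriction of B to a subspace. *)
Definition restrict_form (u v : subvs_of A) : F := B (vsval u) (vsval v).

Fact restrict_form_bilinear : bilinear_for *%R *%R restrict_form.
Proof.
by split=> w k u v; rewrite /restrict_form linearP ?linearPl ?linearPr.
Qed.

Fact restrict_form_sym u v :
  restrict_form u v = (-1) ^+ false * idfun (restrict_form v u).
Proof. by rewrite mul1r; exact: symC. Qed.

HB.instance Definition _ := bilinear_isBilinear.Build F (subvs_of A) (subvs_of A) F
  *%R (idfun \; *%R) restrict_form restrict_form_bilinear.
HB.instance Definition _ :=
  isHermitianSesquilinear.Build F (subvs_of A) false idfun restrict_form
    restrict_form_sym.
End Restriction.
Arguments restrict_form {F V} B A u v.

Section WittExists.
Variables (F : fieldType) (char0 : has_pchar0 F) (V h : vectType F).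
Local Notation "h ^d" := 'Hom(h, F^o) (at level 2, format "h ^d") : type_scope.
(* Here h stands for the quotient V / J, with projection ph and section sh. *)
Variables (B : {symmetric V}) (B_nondeg : nondegenerate B).
Variables (J : {vspace V}) (ph : 'Hom(V, h)) (sh : 'Hom(h, V)).
Hypotheses (shK : cancel sh ph) (ph_eq0 : forall s, (ph s == 0) = (s \in J)).
Hypothesis J_coisotropic : (orthov B J <= J)%VS.

Let I := orthov B J.
Let A := (J :\: I)%VS.
Local Notation a := (subvs_of A).
Let Ba : {symmetric a} := restrict_form B A.

Let ia : 'Hom(a, V) := linfun (vsval : a -> V).
Let iaE u : ia u = vsval u. Proof. exact: lfunE. Qed.

Let BaE u v : Ba u v = B (ia u) (ia v).
Proof. by rewrite !iaE. Qed.

(* J = A + I. *)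
Let J_split j : j \in J -> exists u, j - ia u \in I.
Proof.
move=> jJ; have : j \in (A + I)%VS.
  by rewrite addv_diff (subvP (addvSl _ _)).
case/memv_addP => u uA [i iI ->]; exists (vsproj A u).
by rewrite iaE vsprojK // addrC addKr.
Qed.

Let ia_J u : ia u \in J.
Proof. by rewrite iaE (subvP (diffvSl J I)) ?subvsP. Qed.

Let perpP i j : i \in I -> j \in J -> B i j = 0.
Proof. by move=> /mem_orthovP; apply. Qed.

(** The radical of the restriction of B to J is I, so B is non-degenerate on
    the complement A of I in J. *)
Lemma restrict_form_nondegenerate : nondegenerate Ba.
Proof.
apply/nondegenerateP => u u0.
suff uI : ia u \in I.
  have : ia u \in (A :&: I)%VS by rewrite memv_cap uI iaE subvsP.
  by rewrite capv_diff memv0 iaE => /eqP u00; apply: val_inj.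
apply/mem_orthovP => j jJ; have [v vI] := J_split jJ.
rewrite -(subrK (ia v) j) linearDr /= -BaE u0 addr0 symC.
exact: perpP.
Qed.

Let Ba_nondeg := restrict_form_nondegenerate.

(* The orthogonal projection onto A. *)
Let pa : 'Hom(V, a) := linfun (fun s => sharp Ba (flat B s \o ia)%VF).
Let paE s u : B (ia (pa s)) (ia u) = B s (ia u).
Proof.
rewrite -BaE linfunE ?sharpE ?comp_lfunE ?flatE // => k x y.
by rewrite -linearP; congr (sharp _ _); rewrite linearP comp_lfunDl -comp_lfunZl.
Qed.

(* A linear form on h, pulled back to V, vanishes on J: the vector that
   represents it lies in I. *)
Let id : 'Hom(h^d, V) := linfun (fun al : h^d => sharp B (al \o ph)%VF).
Let idE (al : h^d) s : B (id al) s = al (ph s).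
Proof.
rewrite linfunE ?sharpE ?comp_lfunE // => k x y.
by rewrite -linearP; congr (sharp _ _); rewrite comp_lfunDl -comp_lfunZl.
Qed.

Let id_I (al : h^d) : id al \in I.
Proof.
by apply/mem_orthovP => j; rewrite idE -ph_eq0 => /eqP ->; rewrite linear0.
Qed.

(* The section sh, made orthogonal to A. *)
Let i0 : 'Hom(h, V) := (sh - (ia \o pa \o sh))%VF.
Let i0E x : i0 x = sh x - ia (pa (sh x)).
Proof. by rewrite add_lfunE opp_lfunE !comp_lfunE. Qed.

Let half : F := (2%:R)^-1.

(* The section made isotropic: id (flat B (i0 x) \o i0) pairs with i0 y as i0 x
   does, and I is isotropic, so subtracting half of it cancels the two equal
   contributions to B (i0 x) (i0 y). *)
Let ih : 'Hom(h, V) :=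
  linfun (fun x => i0 x - half *: id (flat B (i0 x) \o i0)%VF).
Let ihE x : ih x = i0 x - half *: id (flat B (i0 x) \o i0)%VF.
Proof.
rewrite linfunE // => k y z.
rewrite !linearP comp_lfunDl -comp_lfunZl linearP /= scalerDr opprD addrACA.
by rewrite scalerBr !scalerA mulrC.
Qed.

Let pd : 'Hom(V, h^d) := linfun (fun s => (flat B s \o ih)%VF).
Let pdE s x : pd s x = B s (ih x).
Proof.
rewrite linfunE ?comp_lfunE ?flatE // => k y z.
by rewrite linearP comp_lfunDl -comp_lfunZl.
Qed.

Let ph_J s : s \in J -> ph s = 0.
Proof. by rewrite -ph_eq0 => /eqP. Qed.

Let id_J al : id al \in J.
Proof. exact: (subvP J_coisotropic). Qed.

Let ph_i0 x : ph (i0 x) = x.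
Proof. by rewrite i0E linearB /= shK (ph_J (ia_J _)) subr0. Qed.

Let ph_ih x : ph (ih x) = x.
Proof.
by rewrite ihE linearB linearZ /= ph_i0 (ph_J (id_J _)) scaler0 subr0.
Qed.

Let id_ia al u : B (id al) (ia u) = 0.
Proof. by rewrite perpP. Qed.

Let id_id al be : B (id al) (id be) = 0.
Proof. by rewrite perpP. Qed.

Let id_ih al x : B (id al) (ih x) = al x.
Proof. by rewrite idE ph_ih. Qed.

Let i0_ia x u : B (i0 x) (ia u) = 0.
Proof. by rewrite i0E linearBl /= paE subrr. Qed.

Let ih_ia x u : B (ih x) (ia u) = 0.
Proof. by rewrite ihE linearBl linearZl_LR /= i0_ia id_ia mulr0 subr0. Qed.

Let ih_ih x y : B (ih x) (ih y) = 0.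
Proof.
rewrite {1}ihE linearBl linearZl_LR /= id_ih comp_lfunE flatE.
rewrite ihE linearBr linearZr_LR /= (symC _ _ (id _)) idE ph_i0.
rewrite comp_lfunE flatE (symC _ (i0 y)).
have half2 : half + half = 1.
  by rewrite -mulr2n -mulr_natr mulVf // (pcharf0P F).1.
by rewrite -addrA -opprD -mulrDl half2 mul1r subrr.
Qed.

Let decomp s : s = ih (ph s) + ia (pa s) + id (pd s).
Proof.
(* The difference d of both sides lies in J and is orthogonal to A and to the
   image of ih.  As it is also orthogonal to I, it is orthogonal to
   V = ih h + A + I. *)
apply/eqP; rewrite -subr_eq0; apply/eqP; set d := s - _.
apply: ((nondegenerateP B).1 B_nondeg) => v.
have dJ : d \in J.
  rewrite -ph_eq0 /d linearB !linearD /= ph_ih (ph_J (ia_J _)) (ph_J (id_J _)).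
  by rewrite !subr0 subrr.
have d_ia u : B d (ia u) = 0.
  by rewrite /d linearBl !linearDl /= ih_ia paE id_ia add0r addr0 subrr.
have d_ih x : B d (ih x) = 0.
  rewrite /d linearBl !linearDl /= ih_ih (symC _ (ia _)) ih_ia id_ih pdE.
  by rewrite !add0r subrr.
rewrite -[v](subrK (ih (ph v))) linearDr /= d_ih addr0.
have : v - ih (ph v) \in J by rewrite -ph_eq0 linearB /= ph_ih subrr.
case/J_split => u uI; rewrite -[X in B d X](subrK (ia u)) linearDr /= d_ia.
by rewrite addr0 symC perpP.
Qed.

(** If the orthogonal of J is contained in J, then V has a Witt splitting whose
    h-component is the given projection of V onto V / J. *)
Lemma witt_splitting_exists : exists (a : vectType F) (Ba : {symmetric a}),
  nondegenerate Ba /\ exists W : witt_splitting B h Ba, prj_h W = ph.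
Proof.
exists a, Ba; split=> //.
have ia_id u al : B (ia u) (id al) = 0 by rewrite symC.
by exists (WittSplitting decomp ih_ih ih_ia id_ih (fun u v => esym (BaE u v))
  ia_id id_id).
Qed.
End WittExists.

(** * Brackets adapted to a Witt splitting *)

Section Recognition.
Variables (F : fieldType) (char0 : has_pchar0 F) (g h : lieAlgType F).
Variable (a : vectType F).
Local Notation "h ^d" := 'Hom(h, F^o) (at level 2, format "h ^d") : type_scope.
Variables (B : {symmetric g}) (Ba : {symmetric a}) (W : witt_splitting B h Ba).
Hypotheses (B_inv : lie_invariant B) (Ba_nondeg : nondegenerate Ba).
Local Notation ih := (inj_h W).
Local Notation ia := (inj_a W).
Local Notation id := (inj_d W).
Local Notation ph := (prj_h W).
Local Notation pa := (prj_a W).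
Local Notation pd := (prj_d W).
(* The elements k u al are those of the kernel of ph, that is, of a + h^*. *)
Let k u (al : h^d) : g := ia u + id al.
Hypothesis prj_h_lie : forall s t, ph [lie s, t] = [lie ph s, ph t].
Hypothesis k_abelian : forall u (al : h^d) v (be : h^d), [lie k u al, k v be] = 0.

Lemma lie_splitE s t :
  [lie s, t] = [lie ih (ph s), ih (ph t)]
    + [lie ih (ph s), k (pa t) (pd t)] - [lie ih (ph t), k (pa s) (pd s)].
Proof.
have kE r : r = ih (ph r) + k (pa r) (pd r) by rewrite /k addrA -witt_decomp.
by rewrite {1}(kE s) {1}(kE t) lieD_abelian ?k_abelian.
Qed.

(** B pairs [s, k] with an element of a as it pairs s with a bracket of two
    elements of ker ph, which is 0. *)
Lemma prj_a_lie_k s u (al : h^d) : pa [lie s, k u al] = 0.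
Proof.
apply: prj_a_eq0 => // v; rewrite lieC linearNl /= B_inv opprK.
have /= := k_abelian u al v 0; rewrite /k linear0 addr0 => ->.
by rewrite linear0r.
Qed.

(** The cochains lambda, mu and the map phi attached to the splitting: the
    components of the bracket of g. *)
Definition split_lambda : h -> h -> a := compress_lie ih pa.
Definition split_mu : h -> h -> h^d := compress_lie ih pd.
Definition split_phi : 'Hom(h, 'Hom(a, h^d)) :=
  linfun (fun x => (pd \o ad (ih x) \o ia)%VF).

Lemma split_phiE x u : split_phi x u = pd [lie ih x, ia u].
Proof.
rewrite linfunE ?comp_lfunE ?adE //.
move=> c y z; apply/lfunP => v; rewrite add_lfunE scale_lfunE !comp_lfunE !adE.
by rewrite linearP linearPl linearP.
Qed.

(** By invariance, h acts on the summand h^* by the coadjoint representation. *)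
Lemma coad_splitE x (al : h^d) : coad x al = pd [lie ih x, id al].
Proof.
apply/lfunP => y; rewrite coadE -form_inj_h B_inv symC form_inj_d.
by rewrite prj_h_lie !prj_inj_h.
Qed.

Lemma prj_d_lie_k x u (al : h^d) :
  pd [lie ih x, k u al] = split_phi x u + coad x al.
Proof. by rewrite split_phiE coad_splitE -linearD -linearDr. Qed.

Lemma prj_a_lie s t : pa [lie s, t] = split_lambda (ph s) (ph t).
Proof. by rewrite lie_splitE linearB linearD /= !prj_a_lie_k addr0 subr0. Qed.

Lemma prj_d_lie s t : pd [lie s, t] = split_mu (ph s) (ph t)
  + (split_phi (ph s) (pa t) + coad (ph s) (pd t))
  - (split_phi (ph t) (pa s) + coad (ph t) (pd s)).
Proof. by rewrite lie_splitE linearB linearD /= !prj_d_lie_k. Qed.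

Fact split_lambdaC x y : split_lambda x y = - split_lambda y x.
Proof. exact: compress_lieC. Qed.

Fact split_muC x y : split_mu x y = - split_mu y x.
Proof. exact: compress_lieC. Qed.

Let split_lambdaNr x y : split_lambda x (- y) = - split_lambda x y.
Proof. exact: linearNr. Qed.

Let split_muNr x y : split_mu x (- y) = - split_mu x y.
Proof. exact: linearNr. Qed.

Let coad0 (x : h) : coad x 0 = 0. Proof. exact: linear0. Qed.
Let coadN (x : h) (al : h^d) : coad x (- al) = - coad x al.
Proof. by rewrite !coad_splitE linearN linearNr linearN. Qed.

(** Closedness of lambda is the a-component of the Jacobi identity on h. *)
Fact split_lambda_closed x y z : CE_d2 (fun _ _ => 0) split_lambda x y z = 0.
Proof.
have /(congr1 pa) := lie_jacobi (ih x) (ih y) (ih z).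
rewrite !linearD linear0 /= !prj_a_lie !prj_h_lie !prj_inj_h /CE_d2.
move=> jac; rewrite -[RHS]jac.
rewrite !(split_lambdaC [lie _, _]) (lieC x z) split_lambdaNr.
by rewrite subrr !add0r !opprK addrC [X in _ + X]addrC addrA.
Qed.

(** The relation between mu and lambda is the h^*-component of the Jacobi
    identity on h. *)
Fact split_mu_closed x y z :
  (split_phi x (split_lambda y z) + split_phi y (split_lambda z x)
      + split_phi z (split_lambda x y)) + CE_d2 (@coad F h) split_mu x y z = 0.
Proof.
have /(congr1 pd) := lie_jacobi (ih x) (ih y) (ih z).
rewrite !linearD linear0 /= !prj_d_lie !prj_h_lie !prj_a_lie !prj_inj_h.
rewrite !prj_a_inj_h // !prj_d_inj_h.
have phi0 t : split_phi t 0 = 0 by exact: linear0.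
rewrite !(phi0, coad0, addr0, subr0) /CE_d2.
rewrite (split_muC x z) coadN.
rewrite !(split_muC [lie _, _]) (lieC x z) split_muNr !opprK.
move=> jac; rewrite -[RHS]jac.
by rewrite !addrA [LHS](ACl (9*1*4*8*2*5*7*3*6))/=.
Qed.

(** The bracket of h with a takes its values in h^*. *)
Lemma lie_inj_a x u : [lie ih x, ia u] = id (split_phi x u).
Proof.
have kE : ia u = k u 0 by rewrite /k linear0 addr0.
rewrite kE [LHS](witt_decomp W) prj_a_lie_k prj_d_lie_k coad0 addr0.
by rewrite prj_h_lie /k linearD /= prj_inj_a prj_inj_d addr0 !linear0 !add0r.
Qed.

(** The cocycle condition on phi is the Jacobi identity for two elements of h
    and one of a. *)
Fact split_phi_cocycle x y u :
  split_phi [lie x, y] u = coad x (split_phi y u) - coad y (split_phi x u).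
Proof.
have -> : coad x (split_phi y u) - coad y (split_phi x u)
    = pd [lie [lie ih x, ih y], ia u].
  rewrite !coad_splitE -!lie_inj_a -linearB; congr (pd _).
  have := lie_jacobi (ih x) (ih y) (ia u).
  rewrite (lieC (ia u) (ih x)) (lieC (ia u)) linearN /=.
  by move/eqP; rewrite subr_eq0 => /eqP.
rewrite prj_d_lie prj_h_lie !prj_inj_h prj_a_inj_a // prj_d_inj_a prj_inj_a.
have -> : split_mu [lie x, y] 0 = 0 by exact: linear0r.
have coad0l al : coad (0 : h) al = 0.
  by apply/lfunP => z; rewrite coadE linear0l linear0 oppr0 zero_lfunE.
by rewrite coad0 coad0l linear0 zero_lfunE !addr0 subr0 add0r.
Qed.

(** The data of the extension isomorphic to g. *)
Definition split_data : ext_data h a :=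
  @ExtData F h a (compress_lie ih pa) (compress_lie ih pd) split_phi
    split_lambdaC split_muC split_phi_cocycle split_lambda_closed split_mu_closed.

Local Notation E := (ext char0 split_data).

(** The isometric isomorphism from g to the extension. *)
Definition split_map : 'Hom(g, E) := linfun (fun s => ((ph s, pa s, pd s) : E)).

Lemma split_mapE s : split_map s = (ph s, pa s, pd s) :> E.
Proof. by rewrite linfunE // => c x y; rewrite !linearP. Qed.

Lemma split_map_bij : bijective split_map.
Proof.
exists (fun p : E => ih p.1.1 + ia p.1.2 + id p.2) => [s|[[x u] al]].
  by rewrite split_mapE -witt_decomp.
rewrite split_mapE /= !linearD /=.
rewrite prj_inj_h prj_inj_a prj_inj_d prj_a_inj_h // prj_a_inj_a // prj_a_inj_d //.
by rewrite prj_d_inj_h prj_d_inj_a prj_d_inj_d !(addr0, add0r).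
Qed.

Lemma split_map_lie s t : split_map [lie s, t] = [lie split_map s, split_map t].
Proof. by rewrite !split_mapE prj_h_lie prj_a_lie prj_d_lie. Qed.

Lemma split_map_isometry : isometry (ext_form char0 split_data Ba) B split_map.
Proof. by move=> s t; rewrite !split_mapE (witt_formE W). Qed.

Lemma ext_form_split_invariant : lie_invariant (ext_form char0 split_data Ba).
Proof.
have [e _ eK] := split_map_bij.
move=> p q r; rewrite -(eK p) -(eK q) -(eK r) -!split_map_lie.
by rewrite !split_map_isometry B_inv.
Qed.
End Recognition.

(** * The characterization *)

Theorem proposition2p1 (F : fieldType) (char0 : has_pchar0 F) :
  (forall (h : lieAlgType F) (a : vectType F) (D : ext_data h a)
      (Ba : {symmetric a}),
    nondegenerate Ba ->
    nondegenerate (ext_form char0 D Ba) /\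
    (lie_invariant (ext_form char0 D Ba) <->
     (forall (x y : h) (u : a), ext_phi D x u y = - Ba (ext_lambda D x y) u) /\
     (forall x y z : h, ext_mu D x y z = ext_mu D y z x)))
  /\
  (forall (g : lieAlgType F) (B : {symmetric g}),
    invariant_metric B -> lie_nilpotent g -> ~ lie_abelian g ->
    exists (h : lieAlgType F) (a : vectType F) (D : ext_data h a)
        (Ba : {symmetric a}),
      [/\ nondegenerate Ba, invariant_metric (ext_form char0 D Ba) &
          exists f : 'Hom(g, ext char0 D),
            [/\ bijective f,
                forall x y : g, f [lie x, y] = [lie f x, f y] &
                isometry (ext_form char0 D Ba) B f]]).
Proof.
split=> [h a D Ba Ba_nondeg|g B B_metric g_nil _].
  by split; [exact: ext_form_nondegenerate|exact: ext_form_invariant].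
have [J [J_ideal J_ab] CJ] := self_centralizing_ideal g_nil.
have J_coiso := subv_trans (orthov_centralizer B_metric J_ideal) CJ.
pose h : lieAlgType F := lie_quotient J_ideal.
have [a [Ba [Ba_nondeg [W WE]]]] := witt_splitting_exists char0 B_metric.1
  (quotient_liftK (J_ideal:=J_ideal)) (quotient_map_eq0 J_ideal) J_coiso.
have ph_lie s t : prj_h W [lie s, t] = [lie prj_h W s, prj_h W t] :> h.
  by rewrite WE; exact: quotient_map_lie.
have kJ u al : inj_a W u + inj_d W al \in J.
  by rewrite -(quotient_map_eq0 J_ideal) -WE linearD /= prj_inj_a prj_inj_d addr0.
have k_ab u al v be :
    [lie inj_a W u + inj_d W al, inj_a W v + inj_d W be] = 0.
  by apply: (centralizerP _ _ (subvP J_ab _ (kJ u al))).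
exists h, a, (split_data B_metric.2 Ba_nondeg ph_lie k_ab), Ba.
split=> //; first split.
- exact: ext_form_nondegenerate.
- exact: ext_form_split_invariant.
exists (split_map char0 B_metric.2 Ba_nondeg ph_lie k_ab); split.
- exact: split_map_bij.
- exact: split_map_lie.
- exact: split_map_isometry.
Qed.
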